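(* For every non-negative integer $k$, there exist infinitely many odd $k$-IGMO numbers.
   Context: For a positive integer $n$, let $D_n$ denote the set of all positive divisors of $n$. For a non-negative integer $k$, a positive integer $n$ is called a $k$-IGMO number if $D_n$ can be partitioned into two disjoint sets $A$ and $B$ (that is, $A \cup B = D_n$ and $A \cap B = \emptyset$) such that $\sum_{d\in A} d - \sum_{d\in B} d = k$. *)

(* Defs.v *)
From mathcomp Require Import all_boot all_order all_algebra finmap.
From mathcomp Require Import classical_sets cardinality.

Set Implicit Arguments.
Unset Strict Implicit.
Unset Printing Implicit Defensive.

Local Open Scope fset_scope.

Definition divisor_set (n : nat) : {fset nat} := [fset d | d in divisors n].

(* The difference of the two sums is taken in [int], where it is not
   truncated.  A part of the partition may be empty. *)
Definition IGMO (k n : nat) : Prop :=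
  (0 < n)%N /\
  exists A B : {fset nat},
    [/\ A `|` B = divisor_set n,
        A `&` B = fset0
      & ((\sum_(d <- A) d)%N%:Z - (\sum_(d <- B) d)%N%:Z = k%:Z)%R].

Lemma in_divisor_set (n d : nat) :
  (0 < n)%N -> (d \in divisor_set n) = (d %| n)%N.
Proof. by move=> n_gt0; rewrite !inE /= dvdn_divisors. Qed.

(* Main.v *)
Require Import Defs.
From mathcomp Require Import all_boot all_order all_algebra finmap.
From mathcomp Require Import classical_sets cardinality.
From mathcomp Require Import zify ring.

(** A partition of the divisors of [n] into two classes amounts to a choice of
    signs, and the difference of the two class sums is the resulting signed sum
    of the divisors.  So the question is which integers are signed divisor sums
    of [n].

    If a prime [p] does not divide [m], the divisors of [m * p ^ a.+1] are the
    divisors of [m] together with [p] times the divisors of [m * p ^ a].  Signs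
    can be chosen independently on the two parts, so the signed divisor sums of
    [m * p ^ a] are exactly the numbers [t_0 + t_1 p + ... + t_a p ^ a] whose
    digits [t_i] are signed divisor sums of [m].  The odd integers in [[-p, p]]
    contain all residues modulo an odd [p]; if all of them are available as
    digits, expanding in base [p] reaches every [z] that has the parity of
    [a + 1] and is not too large for [a + 1] digits, in particular whenever
    [`|z| <= a + 1] ([signed_divisor_sums_mul_prime_power]).

    It remains to find one odd [m] with a suitable [p].  Both parities of [z]
    occur as [a] varies, so a single pair is enough.  The pair [m = 105 ^ 2],
    [p = 11] works ([signed_divisor_sums_square_105]), and then
    [105 ^ 2 * 11 ^ a] is a [k]-IGMO number for every [a >= k] of the parity
    of [k + 1]. *)

Local Open Scope classical_set_scope.

Definition signed_divisor_sum (e : pred nat) (n : nat) : int :=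
  (\sum_(d <- divisors n) (-1) ^+ e d * d%:Z)%R.

Lemma IGMO_signed_divisor_sum (e : pred nat) (k n : nat) :
  (0 < n)%N -> signed_divisor_sum e n = k%:Z%R -> IGMO k n.
Proof.
move=> n_gt0 sum_e; split=> //.
exists [fset d in divisors n | ~~ e d]%fset, [fset d in divisors n | e d]%fset.
split.
- by apply/fsetP => d; rewrite !inE -andb_orr orNb andbT.
- by apply/fsetP => d; rewrite !inE andbACA andNb andbF.
have fset_sum (P : pred nat) :
    (\sum_(d <- [fset d in divisors n | P d]%fset) d)%N
      = (\sum_(d <- divisors n | P d) d)%N.
  rewrite -[RHS]big_filter; apply: perm_big; apply: uniq_perm => //.
    by rewrite filter_uniq ?divisors_uniq.
  by move=> d; rewrite !inE mem_filter andbC.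
rewrite !fset_sum -sum_e /signed_divisor_sum.
rewrite [RHS](bigID e) /= GRing.addrC !(big_morph Posz PoszD (erefl _)) -GRing.sumrN.
by congr (_ + _)%R; apply: eq_bigr => d; [move/negbTE|]; move=> ->;
   rewrite ?GRing.expr0 ?GRing.expr1 ?GRing.mul1r ?GRing.mulN1r.
Qed.

(** The divisors are split according to divisibility by [p]: a divisor prime to
    [p] divides [m], and the others are divided by [p]. *)
Lemma perm_divisors_mul_prime_power (m p a : nat) :
  prime p -> (0 < m)%N -> ~~ (p %| m)%N ->
  perm_eq (divisors (m * p ^ a.+1))
          (divisors m ++ [seq (p * d)%N | d <- divisors (m * p ^ a)]).
Proof.
move=> p_pr m_gt0 pNm; have p_gt0 := prime_gt0 p_pr.
have mp_gt0 b : (0 < m * p ^ b)%N by rewrite muln_gt0 m_gt0 expn_gt0 p_gt0.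
apply: uniq_perm; first exact: divisors_uniq.
  rewrite cat_uniq divisors_uniq map_inj_uniq ?divisors_uniq ?andbT /=.
    apply/hasPn => _ /mapP[d _ ->]; rewrite -dvdn_divisors //.
    by apply: contra pNm; apply: dvdn_trans; apply: dvdn_mulr.
  by move=> x y /eqP; rewrite eqn_pmul2l // => /eqP.
move=> d; rewrite mem_cat -!dvdn_divisors //.
have [/dvdnP[c ->]|pNd] := boolP (p %| d)%N.
  have /negbTE -> : ~~ (c * p %| m)%N.
    by apply: contra pNm; apply: dvdn_trans; apply: dvdn_mull.
  rewrite expnSr mulnA dvdn_pmul2r // (mulnC c p) mem_map -?dvdn_divisors //.
  by move=> x y /eqP; rewrite eqn_pmul2l // => /eqP.
rewrite Gauss_dvdl; last by rewrite coprimeXr // coprime_sym prime_coprime.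
have /negbTE -> : d \notin [seq (p * d)%N | d <- divisors (m * p ^ a)].
  by apply: contra pNd => /mapP[c _ ->]; apply: dvdn_mulr.
by rewrite orbF.
Qed.

Lemma signed_divisor_sum_mul_prime_power (m p a : nat) (e f : pred nat) :
  prime p -> (0 < m)%N -> ~~ (p %| m)%N ->
  exists g : pred nat, signed_divisor_sum g (m * p ^ a.+1)
    = (signed_divisor_sum e m + p%:Z * signed_divisor_sum f (m * p ^ a))%R.
Proof.
move=> p_pr m_gt0 pNm.
exists (fun d => if (p %| d)%N then f (d %/ p)%N else e d).
rewrite /signed_divisor_sum.
rewrite (perm_big _ (@perm_divisors_mul_prime_power m p a p_pr m_gt0 pNm)).
rewrite big_cat big_map /=; congr (_ + _)%R.
  apply: eq_big_seq => d; rewrite -dvdn_divisors // => dm.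
  have /negbTE -> : ~~ (p %| d)%N by apply: contra pNm => /dvdn_trans; apply.
  by [].
rewrite GRing.mulr_sumr; apply: eq_bigr => d _.
by rewrite dvdn_mulr // mulKn ?prime_gt0 // PoszM; ring.
Qed.

(** Of the residue [r] of [z] in [[0, p - 1]] and [r - p], exactly one is odd,
    since [p] is odd. *)
Lemma odd_digit (p : nat) (z : int) : odd p ->
  exists t q : int, [/\ odd `|t|%N, (`|t| <= p)%N & z = (t + p%:Z * q)%R].
Proof.
move=> p_odd; set r := (z %% p)%Z.
have z_def : z = (r + p%:Z * (z %/ p)%Z)%R by rewrite /r {1}(divz_eq z p); ring.
have r_ge0 : (0 <= r)%R by rewrite modz_ge0 //; lia.
have r_lt : (r < p%:Z)%R by rewrite /r ltz_mod //; lia.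
case: (boolP (odd `|r|)) => r_odd.
  by exists r, (z %/ p)%Z; split => //; lia.
exists (r - p%:Z)%R, ((z %/ p)%Z + 1)%R; split; [lia | lia |].
by rewrite {1}z_def; ring.
Qed.

(** Expansion in base [p] with odd digits.  With [z = t + p * q], the quotient has
    [p * `|q| <= `|z| + p], which brings the bound [a + 2] on [`|z|] down to
    [a + 1] on [`|q|]; as [p] and [t] are odd, [q] and [z] have opposite
    parities.  The bound [a + 1] is far from optimal, but it tends to infinity
    with [a], which is all that is required of it. *)
Lemma signed_divisor_sums_mul_prime_power (m p : nat) :
  prime p -> odd p -> (0 < m)%N -> ~~ (p %| m)%N ->
  (forall t : int, odd `|t|%N -> (`|t| <= p)%N ->
     exists e, signed_divisor_sum e m = t) ->
  forall (a : nat) (z : int), odd `|z|%N = odd a.+1 -> (`|z| <= a.+1)%N ->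
    exists e, signed_divisor_sum e (m * p ^ a) = z.
Proof.
move=> p_pr p_odd m_gt0 pNm digits; have p_gt1 := prime_gt1 p_pr.
elim=> [|a IHa] z z_odd z_le.
  by rewrite expn0 muln1; apply: digits; lia.
have [t [q [t_odd t_le z_def]]] := odd_digit p z p_odd.
have [e e_t] := digits t t_odd t_le.
have [f f_q] : exists f, signed_divisor_sum f (m * p ^ a) = q.
  apply: IHa.
    have [c pE] : exists c, p = c.*2.+1 by exists p./2; lia.
    have pE_int : p%:Z%R = (2 * c%:Z + 1)%R by lia.
    have : z = (t + 2 * (c%:Z * q) + q)%R by rewrite z_def pE_int; ring.
    by lia.
  have : (p * `|q| <= `|z| + `|t|)%N.
    by rewrite -(abszM p%:Z); lia.
  by nia.
have [g gE] := signed_divisor_sum_mul_prime_power m p a e f p_pr m_gt0 pNm.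
by exists g; rewrite gE e_t f_q z_def.
Qed.

(** The divisors of [105 ^ 2] other than 1, 3, 5, 7, 9 add up to 22946, and
    those among them listed in [minus] below add up to half of this, 11473; so
    the large divisors cancel, and the signs of 1, 3, 5, 7, 9 remain free to
    produce [t]. *)
Lemma signed_divisor_sums_square_105 (t : int) :
  odd `|t|%N -> (`|t| <= 11)%N ->
  exists e, signed_divisor_sum e (105 ^ 2) = t.
Proof.
move=> t_odd t_le.
pose minus (s : seq nat) : pred nat := mem (s ++ [:: 25; 45; 63; 315; 105 ^ 2]).
have minus_sum s :
    signed_divisor_sum (minus s) (105 ^ 2)
    = foldr (fun d z => ((-1) ^+ minus s d * d%:Z + z)%R) 0%R (divisors (105 ^ 2)).
  by rewrite /signed_divisor_sum unlock.
(* Each [t] comes with the elements of {1, 3, 5, 7, 9} to be counted negatively;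
   their sum is [(25 - t) / 2]. *)
pose witnesses : seq (int * seq nat) :=
  [:: (-11, [:: 1; 3; 5; 9]); (-9, [:: 1; 7; 9]); (-7, [:: 7; 9]);
      (-5, [:: 1; 5; 9]); (-3, [:: 5; 9]); (-1, [:: 1; 3; 9]);
      (1, [:: 3; 9]); (3, [:: 1; 3; 7]); (5, [:: 1; 9]);
      (7, [:: 9]); (9, [:: 1; 7]); (11, [:: 7])]%R.
have /allP witnessesP :
    all (fun w => signed_divisor_sum (minus w.2) (105 ^ 2) == w.1) witnesses.
  by rewrite /witnesses /all !minus_sum; vm_compute.
have /mapP[w w_in ->] : t \in map fst witnesses by rewrite !inE /=; lia.
by exists (minus w.2); apply/eqP/witnessesP.
Qed.

Theorem theorem1 (k : nat) : infinite_set [set n : nat | odd n /\ IGMO k n].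
Proof.
(* The exponent has the parity of [k + 1], so that the signed divisor sums have
   the parity of [k], and it is at least [k], so that they reach [k]. *)
pose N j := (105 ^ 2 * 11 ^ (k + j.*2).+1)%N.
apply: (@sub_infinite_set _ (N @` [set: nat])).
  move=> _ [j _ <-]; split; first by rewrite oddM !oddX orbT.
  have [||e eE] := signed_divisor_sums_mul_prime_power (105 ^ 2) 11 isT isT isT
                   isT signed_divisor_sums_square_105 (k + j.*2).+1 k%:Z%R.
  - by lia.
  - by lia.
  by apply: IGMO_signed_divisor_sum eE; rewrite muln_gt0 !expn_gt0.
rewrite (eq_finite_set (inj_card_eq _)); first exact: infinite_nat.
move=> i j _ _ /eqP; rewrite eqn_pmul2l ?expn_gt0 // eqn_exp2l //.
by lia.
Qed.
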